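(* Let $f:\mathbb{R}^n\to\mathbb{R}$ be differentiable with $L$-Lipschitz continuous gradient for some $L>0$, and suppose $f_{\inf}:=\inf_{x\in\mathbb{R}^n} f(x)>-\infty$. Let $0<\alpha\le 1$, $\rho>0$, $0<h\le 1/L$, $x_0\in\mathbb{R}^n$, and let $(x_k)$ be generated by the constant-$\rho$ $\mathrm{SAM}_\alpha$ iteration $$y_k=x_k+\rho\,\frac{\nabla f(x_k)}{\|\nabla f(x_k)\|^{\alpha}},\qquad x_{k+1}=x_k-h\nabla f(y_k).$$ Put $\Delta_0=f(x_0)-f_{\inf}$ and $\varepsilon_\alpha=(L\rho)^{1/\alpha}$. Then for every $\varepsilon>\varepsilon_\alpha$ and every positive integer $T$ satisfying $$T>\frac{2\Delta_0}{h\,\varepsilon^{2(1-\alpha)}\left(\varepsilon^{2\alpha}-L^2\rho^2\right)},$$ there exists an index $0\le k<T$ such that $\|\nabla f(x_k)\|\le\varepsilon$.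
   Context: $\|\cdot\|$ is the Euclidean norm on $\mathbb{R}^n$. Stopping convention: the method stops at $x_k$ if $\nabla f(x_k)=0$ (so the undefined normalized direction never occurs); in that case the sequence is understood to be constant from that index on, i.e. $x_j=x_k$ for all $j\ge k$. *)

(* Defs.v *)
From HB Require Import structures.
From mathcomp Require Import all_boot all_order all_algebra.
From mathcomp Require Import all_classical all_reals all_analysis.
Set Implicit Arguments.
Unset Strict Implicit.
Unset Printing Implicit Defensive.
Import Order.TTheory GRing.Theory Num.Theory.
Import numFieldNormedType.Exports.

Local Open Scope classical_set_scope.
Local Open Scope ring_scope.

(* The canonical norm `|x| on 'rV[R]_n is the sup norm, so the Euclidean norm
   is defined separately.  The two are equivalent: [differentiable] on 'rV[R]_n
   does not depend on which one is used. *)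
Definition enorm (R : realType) (n : nat) (x : 'rV[R]_n) : R :=
  Num.sqrt (\sum_(i < n) x ord0 i ^+ 2).

Definition grad (R : realType) (n : nat) (f : 'rV[R]_n -> R) (x : 'rV[R]_n) :
    'rV[R]_n :=
  \row_(i < n) 'D_(delta_mx ord0 i) f x.

(* [L]-Lipschitz on the whole space for the Euclidean norm; the library's
   lipschitz notions would refer to the sup norm. *)
Definition elipschitz (R : realType) (n : nat) (L : R)
    (g : 'rV[R]_n -> 'rV[R]_n) : Prop :=
  forall x y : 'rV[R]_n, enorm (g x - g y) <= L * enorm (x - y).

(* The infimum is taken in the extended reals, so that it may be -oo. *)
Definition finf (R : realType) (n : nat) (f : 'rV[R]_n -> R) : \bar R :=
  ereal_inf (range (fun x => (f x)%:E)).

Definition sam_ascent (R : realType) (n : nat) (f : 'rV[R]_n -> R)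
    (alpha rho : R) (x : 'rV[R]_n) : 'rV[R]_n :=
  x + rho *: ((enorm (grad f x) `^ alpha)^-1 *: grad f x).

(* The method stops at [x k] when the gradient vanishes there, and the sequence
   is then constant from index [k] on. *)
Definition sam_sequence (R : realType) (n : nat) (f : 'rV[R]_n -> R)
    (alpha rho h : R) (x : nat -> 'rV[R]_n) : Prop :=
  forall k : nat,
    (grad f (x k) = 0 -> forall j : nat, (k <= j)%N -> x j = x k) /\
    (grad f (x k) <> 0 ->
       x k.+1 = x k - h *: grad f (sam_ascent f alpha rho (x k))).

(* Main.v *)
Require Import Defs.
From HB Require Import structures.
From mathcomp Require Import all_boot all_order all_algebra.
From mathcomp Require Import all_classical all_reals all_analysis.
From mathcomp Require Import ring lra.
Set Implicit Arguments.
Unset Strict Implicit.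
Unset Printing Implicit Defensive.
Import Order.TTheory GRing.Theory Num.Theory.
Import numFieldNormedType.Exports.

Local Open Scope classical_set_scope.
Local Open Scope ring_scope.

(** The SAM step moves [x] by [- h u], where [u] is the gradient at the ascent
point [y] instead of the gradient [g] at [x] itself, so it is a gradient step
with an error [g - u].  For [h <= 1/L] the descent lemma gives
  [f (x - h u) <= f x - h/2 (|g|^2 - |g - u|^2)]
([inexact_step_decrease]): the step decreases [f] as soon as the error is
smaller than the gradient.  The ascent displacement has length
[rho |g|^(1 - alpha)], so by the Lipschitz bound the error is at most
[L rho |g|^(1 - alpha)] ([sam_gradient_error]), and the decrease is at least
[h/2] times
  [|g|^2 - (L rho)^2 |g|^(2 (1 - alpha))
     = |g|^(2 (1 - alpha)) (|g|^(2 alpha) - (L rho)^2)].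
The threshold [(L rho)^(1/alpha)] is exactly the value of [|g|] above which
this is positive.  Above it both factors are nondecreasing in [|g|], so as long
as [|g| >= eps] each step lowers [f] by at least the value of the bound at
[eps] ([sam_step_decrease]).  If all of the first [T] gradients were larger
than [eps], then [f] would drop by [T] times this amount; the lower bound on
[T] makes this exceed [f x0 - inf f], a contradiction. *)

Definition edot (R : realType) (n : nat) (u v : 'rV[R]_n) : R :=
  \sum_(i < n) u ord0 i * v ord0 i.

Section EuclideanNorm.
Variables (R : realType) (n : nat).
Implicit Types u v : 'rV[R]_n.

Lemma enorm_ge0 u : 0 <= enorm u.
Proof. exact: sqrtr_ge0. Qed.

Lemma sqr_enorm u : enorm u ^+ 2 = \sum_(i < n) u ord0 i ^+ 2.
Proof. by rewrite sqr_sqrtr// sumr_ge0// => i _; exact: sqr_ge0. Qed.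

Lemma enormZ (a : R) u : enorm (a *: u) = `|a| * enorm u.
Proof.
rewrite /enorm -sqrtr_sqr -sqrtrM ?sqr_ge0// mulr_sumr.
by congr Num.sqrt; apply: eq_bigr => i _; rewrite mxE exprMn.
Qed.

Lemma enormN u : enorm (- u) = enorm u.
Proof. by rewrite -scaleN1r enormZ normrN1 mul1r. Qed.

Lemma enorm0 : enorm (0 : 'rV[R]_n) = 0.
Proof. by rewrite -(scale0r 0) enormZ normr0 mul0r. Qed.

Lemma edotZr (a : R) u v : edot u (a *: v) = a * edot u v.
Proof. by rewrite /edot mulr_sumr; apply: eq_bigr => i _; rewrite mxE mulrCA. Qed.

Lemma edotBl u v w : edot (u - v) w = edot u w - edot v w.
Proof. by rewrite /edot -sumrB; apply: eq_bigr => i _; rewrite !mxE mulrBl. Qed.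

Lemma edotNr u v : edot u (- v) = - edot u v.
Proof. by rewrite -scaleN1r edotZr mulN1r. Qed.

Lemma polarization u v :
  2 * edot u v = enorm u ^+ 2 + enorm v ^+ 2 - enorm (u - v) ^+ 2.
Proof.
rewrite !sqr_enorm /edot mulr_sumr -big_split -sumrB/=.
by apply: eq_bigr => i _; rewrite !mxE; ring.
Qed.

(** Cauchy-Schwarz in the form the descent lemma needs.  Since a bound [s] on the
ratio of the norms is known, it suffices to expand [0 <= |u - s v|^2], without
normalizing [u] and [v] or treating null vectors apart. *)
Lemma edot_le u v (s : R) : 0 < s -> enorm u <= s * enorm v ->
  edot u v <= s * enorm v ^+ 2.
Proof.
move=> s_gt0 uv.
rewrite -(ler_pM2l (mulr_gt0 (ltr0n _ 2) s_gt0)) -mulrA -edotZr polarization.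
rewrite enormZ gtr0_norm//.
have := sqr_ge0 (enorm (u - s *: v)).
have : enorm u ^+ 2 <= (s * enorm v) ^+ 2.
  by rewrite ler_sqr ?nnegrE ?mulr_ge0 ?enorm_ge0 ?(ltW s_gt0).
move: (enorm u) (enorm v) (enorm _) => a b c uv2 c2; lra.
Qed.

End EuclideanNorm.

Section Descent.
Variables (R : realType) (n : nat) (f : 'rV[R]_n -> R).
Hypothesis f_diff : forall z, differentiable f z.

(** The gradient is defined by partial derivatives; differentiability, that is,
linearity of the differential, makes it determine all directional
derivatives. *)
Lemma derive_edot_grad (z v : 'rV[R]_n) : 'D_v f z = edot (grad f z) v.
Proof.
rewrite deriveE// {1}(row_sum_delta v) linear_sum; apply: eq_bigr => i _.
by rewrite linearZ /= mxE deriveE// mulrC.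
Qed.

Lemma is_derive_line (z v : 'rV[R]_n) (t : R) :
  is_derive t 1 (fun s : R => f (z + s *: v)) (edot (grad f (z + t *: v)) v).
Proof.
have quotE : (fun h : R => h^-1 *: (((fun s : R => f (z + s *: v)) \o shift t)
      (h *: (1 : R)) - f (z + t *: v))) =
    (fun h : R => h^-1 *: ((f \o shift (z + t *: v)) (h *: v) - f (z + t *: v))).
  apply/funext => h /=; congr (_ *: (f _ - _)).
  by rewrite [h *: (1 : R)]mulr1 scalerDl addrCA.
split; first by rewrite /derivable quotE; exact: diff_derivable.
by rewrite /derive quotE -derive_edot_grad.
Qed.

(** The quadratic upper bound for a function with Lipschitz gradient.  The gap
between the two sides along the segment from [z] to [z + v] has a nonpositive
derivative, because the slope of [f] at parameter [t] exceeds that at [0] by at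
most [L t |v|^2].  The mean value theorem is applied to the gap rather than to
[f], which would lose the factor [1/2]. *)
Lemma descent_lemma (L : R) (z v : 'rV[R]_n) : 0 < L -> elipschitz L (grad f) ->
  f (z + v) <= f z + edot (grad f z) v + L / 2 * enorm v ^+ 2.
Proof.
move=> L_gt0 lip.
pose a := edot (grad f z) v.
pose b := L / 2 * enorm v ^+ 2.
pose gap (t : R) := f (z + t *: v) - t * a - t ^+ 2 * b.
have dgap (t : R) :
    is_derive t (1 : R) gap (edot (grad f (z + t *: v)) v - a - 2 * t * b).
  have ? := is_derive_line z v t.
  by rewrite /gap; apply: is_derive_eq; rewrite /GRing.scale/=; ring.
have gap_cont : {within `[0, 1], continuous gap}.
  by apply: derivable_within_continuous => t _; have [] := dgap t.
have [t] := MVT ltr01 (fun t _ => dgap t) gap_cont.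
rewrite in_itv/= => /andP[t_gt0 _].
have : edot (grad f (z + t *: v)) v - a <= 2 * t * b.
  rewrite /a -edotBl (_ : 2 * t * b = (L * t) * enorm v ^+ 2); last first.
    by rewrite /b; field.
  apply: edot_le; first exact: mulr_gt0.
  apply: (le_trans (lip _ _)).
  by rewrite [z + _]addrC addrK enormZ gtr0_norm// mulrA.
rewrite /gap scale1r scale0r addr0 /a /b => slope gapE; lra.
Qed.

End Descent.

Section SAM.
Variables (R : realType) (n : nat) (f : 'rV[R]_n -> R) (L alpha rho h : R).
Hypothesis f_diff : forall z, differentiable f z.
Hypothesis L_gt0 : 0 < L.
Hypothesis grad_lip : elipschitz L (grad f).

(** In the descent lemma the quadratic term is at most [h/2 |u|^2] by [h L <= 1];
polarizing the linear term [- h <g, u>] cancels it exactly. *)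
Lemma inexact_step_decrease (z u : 'rV[R]_n) : 0 < h -> h <= 1 / L ->
  f (z - h *: u) <=
    f z - h / 2 * (enorm (grad f z) ^+ 2 - enorm (grad f z - u) ^+ 2).
Proof.
move=> h_gt0 h_le.
apply: (le_trans (@descent_lemma _ _ _ f_diff L z (- (h *: u)) L_gt0 grad_lip)).
rewrite enormN enormZ gtr0_norm// edotNr edotZr.
have -> : edot (grad f z) u =
    (enorm (grad f z) ^+ 2 + enorm u ^+ 2 - enorm (grad f z - u) ^+ 2) / 2.
  by rewrite -polarization; field.
have hL : h * L <= 1 by rewrite -ler_pdivlMr.
have : h * L * (h * enorm u ^+ 2) <= 1 * (h * enorm u ^+ 2).
  by rewrite ler_wpM2r// mulr_ge0 ?sqr_ge0 ?ltW.
move: (enorm _) (enorm _) (enorm _) => c d e hLd; lra.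
Qed.

(** Normalizing by [|g|^alpha] gives the ascent displacement the length
[rho |g|^(1 - alpha)]. *)
Lemma sam_gradient_error z : 0 < rho -> 0 < enorm (grad f z) ->
  enorm (grad f z - grad f (sam_ascent f alpha rho z)) <=
    L * rho * enorm (grad f z) `^ (1 - alpha).
Proof.
move=> rho_gt0 g_gt0; apply: (le_trans (grad_lip _ _)).
rewrite /sam_ascent opprD addNKr enormN !enormZ gtr0_norm//.
rewrite gtr0_norm ?invr_gt0 ?powR_gt0//.
rewrite powRB ?lt0r_neq0 ?implybT// powRr1 ?(ltW g_gt0)//.
by rewrite -mulrA (mulrC _^-1).
Qed.

(** Factors the guaranteed decrease so that its sign and its monotonicity in [e]
above the threshold become visible. *)
Lemma powR_sqr_gap (e : R) : 0 < e ->
  e ^+ 2 - (L * rho * e `^ (1 - alpha)) ^+ 2 =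
  e `^ (2 * (1 - alpha)) * (e `^ (2 * alpha) - L ^+ 2 * rho ^+ 2).
Proof.
move=> e_gt0.
rewrite mulrBr -powRD ?lt0r_neq0 ?implybT//.
rewrite (_ : 2 * (1 - alpha) + 2 * alpha = 2%:R); last by ring.
rewrite powR_mulrn ?ltW// [2 * (1 - alpha)]mulrC powRrM powR_mulrn ?powR_ge0//.
by ring.
Qed.

Lemma powR_gap_gt0 (e : R) : 0 < alpha -> 0 < rho ->
  (L * rho) `^ (1 / alpha) < e -> 0 < e `^ (2 * alpha) - L ^+ 2 * rho ^+ 2.
Proof.
move=> a_gt0 r_gt0 lt_e.
have Lr_gt0 : 0 < L * rho by exact: mulr_gt0.
have e_gt0 : 0 < e by apply: le_lt_trans lt_e; exact: powR_ge0.
have := gt0_ltr_powR a_gt0 _ _ lt_e.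
rewrite !nnegrE powR_ge0 (ltW e_gt0) => /(_ isT isT).
rewrite -powRrM divfK ?gt_eqF// powRr1 ?ltW// => Lr_lt.
rewrite subr_gt0 -exprMn [2 * _]mulrC powRrM powR_mulrn ?powR_ge0//.
by rewrite ltr_pXn2r ?nnegrE ?powR_ge0 ?(ltW Lr_gt0).
Qed.

(** The decrease is guaranteed in terms of [|g|]; it is at least its value at [e]
because both factors of [powR_sqr_gap] are nonnegative at [e] and nondecreasing
from there on, their exponents being nonnegative ([0 < alpha <= 1]). *)
Lemma sam_step_decrease z (e : R) : 0 < alpha -> alpha <= 1 -> 0 < rho ->
    0 < h -> h <= 1 / L ->
    (L * rho) `^ (1 / alpha) < e -> e <= enorm (grad f z) ->
  f (z - h *: grad f (sam_ascent f alpha rho z)) <=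
    f z - h / 2 * (e `^ (2 * (1 - alpha)) *
                   (e `^ (2 * alpha) - L ^+ 2 * rho ^+ 2)).
Proof.
move=> a_gt0 a_le1 r_gt0 h_gt0 h_le lt_e le_g.
have e_gt0 : 0 < e by apply: le_lt_trans lt_e; exact: powR_ge0.
have g_gt0 : 0 < enorm (grad f z) by exact: lt_le_trans le_g.
apply: (le_trans (inexact_step_decrease _ _ h_gt0 h_le)).
rewrite lerD2l lerN2 ler_pM2l ?divr_gt0//.
apply: (@le_trans _ _ (enorm (grad f z) `^ (2 * (1 - alpha)) *
  (enorm (grad f z) `^ (2 * alpha) - L ^+ 2 * rho ^+ 2))).
  have powR_le r : 0 <= r -> e `^ r <= enorm (grad f z) `^ r.
    by move=> r_ge0; apply: ge0_ler_powR; rewrite ?nnegrE ?(ltW e_gt0) ?(ltW g_gt0).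
  apply: ler_pM; first exact: powR_ge0.
  - exact/ltW/powR_gap_gt0.
  - by rewrite powR_le// mulr_ge0// subr_ge0.
  - by rewrite lerD2r powR_le// mulr_ge0// ltW.
rewrite -powR_sqr_gap// lerD2l lerN2 ler_pXn2r ?nnegrE ?enorm_ge0//.
  exact: sam_gradient_error.
by rewrite !mulr_ge0 ?powR_ge0 ?ltW.
Qed.

Lemma finf_le z : (-oo < finf f)%E -> fine (finf f) <= f z.
Proof.
move=> f_bdd.
have inf_le : (finf f <= (f z)%:E)%E by apply: ereal_inf_lbound; exists z.
rewrite -lee_fin fineK// fin_numElt f_bdd.
by apply: le_lt_trans inf_le _; exact: ltry.
Qed.

End SAM.

Theorem theorem3 (R : realType) (n : nat) (f : 'rV[R]_n -> R)
    (L alpha rho h : R) (x0 : 'rV[R]_n) (x : nat -> 'rV[R]_n)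
    (f_diff : forall z : 'rV[R]_n, differentiable f z)
    (L_gt0 : 0 < L)
    (grad_lip : elipschitz L (grad f))
    (f_bdd : (-oo < finf f)%E)
    (alpha_gt0 : 0 < alpha) (alpha_le1 : alpha <= 1)
    (rho_gt0 : 0 < rho)
    (h_gt0 : 0 < h) (h_le : h <= 1 / L)
    (x_start : x 0%N = x0)
    (x_sam : sam_sequence f alpha rho h x) :
  let Delta0 := f x0 - fine (finf f) in
  let eps_alpha := (L * rho) `^ (1 / alpha) in
  forall (eps : R) (T : nat),
    eps_alpha < eps -> (0 < T)%N ->
    2 * Delta0 / (h * eps `^ (2 * (1 - alpha)) *
                  (eps `^ (2 * alpha) - L ^+ 2 * rho ^+ 2)) < T%:R ->
  exists k : nat, (k < T)%N /\ enorm (grad f (x k)) <= eps.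
Proof.
move=> Delta0 eps_alpha eps T lt_eps T_gt0.
have eps_gt0 : 0 < eps by apply: le_lt_trans lt_eps; exact: powR_ge0.
have drop_gt0 : 0 < eps `^ (2 * (1 - alpha)) *
    (eps `^ (2 * alpha) - L ^+ 2 * rho ^+ 2).
  by rewrite mulr_gt0 ?powR_gt0// powR_gap_gt0.
rewrite -[h * _ * _]mulrA; set drop := _ * (_ - _) in drop_gt0 *.
rewrite (ltr_pdivrMr _ _ (mulr_gt0 h_gt0 drop_gt0))// => T_large.
apply/not_existsP => small_none.
have large k : (k < T)%N -> eps < enorm (grad f (x k)).
  by move=> k_lt; rewrite ltNge; apply/negP => ?; exact: (small_none k).
have total k : (k <= T)%N -> f (x k) <= f x0 - k%:R * (h / 2 * drop).
  elim: k => [_|k IHk k_lt]; first by rewrite x_start mul0r subr0.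
  have [_ ->] := x_sam k; last first.
    (* The method cannot have stopped: a zero gradient is below [eps]. *)
    by move=> g0; have := large _ k_lt; rewrite g0 enorm0 ltNge ltW.
  apply: (le_trans (sam_step_decrease f_diff L_gt0 grad_lip alpha_gt0 alpha_le1
    rho_gt0 h_gt0 h_le lt_eps (ltW (large _ k_lt)))).
  by rewrite -/drop -[k.+1%:R]natr1 mulrDl mul1r opprD addrA lerD2r IHk// ltnW.
have := le_trans (finf_le (x T) f_bdd) (total T (leqnn T)).
rewrite /Delta0 in T_large => total_T; lra.
Qed.
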